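(* Let $(M_i,g_i)$, $i=1,2$, be Riemannian manifolds. The gradients, with respect to $G_{f_1f_2}$, of the lifts $f_1^h$ of $f_1$ and $f_2^v$ of $f_2$ to $M_1\times M_2$ are $$\mathrm{grad}(f_1^h)=\frac{1}{1-c^2b_1^hb_2^v}\Big\{\frac{1}{(f_2^v)^2}(\mathrm{grad} f_1)^h-\frac{c\,b_1^h}{f_1^hf_2^v}(\mathrm{grad} f_2)^v\Big\},$$ $$\mathrm{grad}(f_2^v)=\frac{1}{1-c^2b_1^hb_2^v}\Big\{\frac{1}{(f_1^h)^2}(\mathrm{grad} f_2)^v-\frac{c\,b_2^v}{f_1^hf_2^v}(\mathrm{grad} f_1)^h\Big\},$$ where $b_i=\|\mathrm{grad} f_i\|^2$, $i=1,2$.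
   Context: $\pi_i:M_1\times M_2\to M_i$ are the projections; $\varphi_1^h=\varphi_1\circ\pi_1$ and $\varphi_2^v=\varphi_2\circ\pi_2$ are the lifts of functions. The horizontal lift $X_1^h$ of a vector field $X_1$ on $M_1$ is the vector field on $M_1\times M_2$ with $d\pi_1(X_1^h)=X_1\circ\pi_1$, $d\pi_2(X_1^h)=0$; the vertical lift $X_2^v$ of a vector field on $M_2$ is defined symmetrically. $f_i:M_i\to(0,\infty)$ is smooth, $c\in\mathbb R$, and $$G_{f_1f_2}=(f_2^v)^2\pi_1^*g_1+(f_1^h)^2\pi_2^*g_2+c f_1^hf_2^v\,df_1^h\odot df_2^v,\qquad \alpha\odot\beta=\alpha\otimes\beta+\beta\otimes\alpha.$$ $\mathrm{grad} f_i$ and $\|\mathrm{grad} f_i\|$ on $M_i$ are taken with respect to $g_i$. Standing assumption: $0\le c^2b_1^hb_2^v<1$ everywhere, so that $G_{f_1f_2}$ is a Riemannian metric on $M_1\times M_2$. *)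

(* Defs.v *)
From HB Require Import structures.
From mathcomp Require Import all_boot all_order all_algebra.
From mathcomp Require Import all_classical all_reals.
From mathcomp Require Import topology normedtype landau derive.

Set Implicit Arguments.
Unset Strict Implicit.
Unset Printing Implicit Defensive.

Import Order.TTheory GRing.Theory Num.Theory.
Import numFieldNormedType.Exports.

Local Open Scope classical_set_scope.
Local Open Scope ring_scope.

Section Smooth.
Context {R : realType}.
Implicit Types U V : normedModType R.

Section Ck.
Context {U V : normedModType R} (A : set U).

(* [f] is k times continuously differentiable on the open set [A]; the values
   of [f] outside [A] play no role. *)
Fixpoint Ck (k : nat) (f : U -> V) : Prop :=
  if k is k'.+1 then
    (forall x, A x -> differentiable f x) /\
    forall v, Ck k' (fun x => 'd f x v)
  else forall x, A x -> {for x, continuous f}.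

Definition smooth_on (f : U -> V) := forall k, Ck k f.

End Ck.

Lemma diff_near_eq U V (f g : U -> V) (x : U) :
  (\near x, f x = g x) -> differentiable f x ->
  differentiable g x /\ 'd g x = 'd f x :> (U -> V).
Proof.
move=> fg df.
have fgx : f x = g x by apply: (nbhs_singleton fg).
have E : g \o shift x = cst (g x) + 'd f x +o_ (0 : U) id.
  rewrite -fgx.
  have := diff_locally df => /eqaddoP H; apply/eqaddoP => e e0.
  have {}H := H e e0.
  have fg' : \forall y \near (0 : U), f (y + x) = g (y + x).
    rewrite (near_shift x) /=; near=> y => /=.
    by rewrite ?sub0r ?subr0 subrK; near: y.
  near=> y; have -> : (g \o shift x - (cst (f x) + 'd f x)) y =
      (f \o shift x - (cst (f x) + 'd f x)) y.
    by rewrite !fctE /= -(near fg' y).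
  by near: y.
have du : 'd g x = 'd f x :> (U -> V).
  by apply: diff_unique => //; exact: diff_continuous.
split=> //; apply/diff_locallyP; rewrite du; split=> //.
exact: diff_continuous.
Unshelve. all: by end_near. Qed.

Lemma Ck_eq k U V (A : set U) (f g : U -> V) : open A ->
  (forall x, A x -> f x = g x) -> Ck A k f -> Ck A k g.
Proof.
move=> oA; elim: k f g => [|k IH] f g fg.
  move=> cf x Ax.
  have fgn : \near x, f x = g x.
    by near=> y; apply: fg; near: y; exact: open_nbhs_nbhs.
  rewrite /prop_for /continuous_at -(fg _ Ax).
  by apply: cvg_trans (cf x Ax); apply: near_eq_cvg.
have fgn x : A x -> \near x, f x = g x.
  by move=> Ax; near=> y; apply: fg; near: y; exact: open_nbhs_nbhs.
move=> [df Cf]; split=> [x Ax|v].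
  by have [] := diff_near_eq (fgn x Ax) (df x Ax).
apply: IH (Cf v) => x Ax.
by have [_ ->] := diff_near_eq (fgn x Ax) (df x Ax).
Unshelve. all: by end_near. Qed.

Lemma Ck_sub k U V (A B : set U) (f : U -> V) :
  B `<=` A -> Ck A k f -> Ck B k f.
Proof.
move=> BA; elim: k f => [|k IH] f /=; first by move=> cf x /BA; exact: cf.
by move=> [df Cf]; split=> [x /BA|v]; [exact: df|exact: IH].
Qed.

Lemma CkD k U V (A : set U) (f g : U -> V) : open A ->
  Ck A k f -> Ck A k g -> Ck A k (f \+ g).
Proof.
move=> oA; elim: k f g => [|k IH] f g.
  by move=> cf cg x Ax; apply: cvgD; [exact: cf|exact: cg].
move=> [df Cf] [dg Cg]; split=> [x Ax|v].
  by apply: differentiableD; [exact: df|exact: dg].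
apply: Ck_eq (IH _ _ (Cf v) (Cg v)) => // x Ax.
by rewrite /= diffD //; [exact: df|exact: dg].
Qed.

Lemma Ck_lin k U V U' V' (A : set U) (f : U -> V)
    (L : {linear U' -> U}) (K : {linear V -> V'}) :
  continuous L -> continuous K -> open A ->
  Ck A k f -> Ck (L @^-1` A) k (fun x => K (f (L x))).
Proof.
move=> cL cK oA.
have oB : open (L @^-1` A) by apply: open_comp => // x _; exact: cL.
elim: k f => [|k IH] f.
  move=> cf x Ax.
  apply: (@continuous_comp _ _ _ (f \o L) K); last exact: cK.
  by apply: continuous_comp; [exact: cL|exact: cf].
have dL x : differentiable L x by exact: linear_differentiable.
have dK x : differentiable K x by exact: linear_differentiable.
move=> [df Cf]; split=> [x Ax|v].
  apply: (@differentiable_comp _ _ _ _ (f \o L) K) => //.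
  by apply: differentiable_comp => //; exact: df.
apply: Ck_eq (IH _ (Cf (L v))) => // x Ax.
have dfL : differentiable f (L x) by exact: df.
have -> : 'd (fun x => K (f (L x))) x = K \o ('d f (L x) \o L) :> (U' -> V').
  rewrite (@diff_comp _ _ _ _ (f \o L) K) ?diff_lin //.
    by rewrite diff_comp ?diff_lin.
  exact: differentiable_comp.
by [].
Qed.

End Smooth.

Lemma open_setX (S T : topologicalType) (A : set S) (B : set T) :
  open A -> open B -> open (A `*` B).
Proof.
move=> oA oB; have -> : A `*` B = (fst @^-1` A) `&` (snd @^-1` B) by [].
by apply: openI; apply: open_comp => // x _; [exact: cvg_fst|exact: cvg_snd].
Qed.

Section Manifold.
Context {R : realType}.

(* A homeomorphism from the open set [cdom] onto an open set of R^n. [cfun] and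
   [cinv] are total functions, constrained only on these two sets. *)
Record chart (n : nat) (T : topologicalType) := Chart {
  cdom : set T;
  cfun : T -> 'rV[R]_n;
  cinv : 'rV[R]_n -> T;
  cdom_open : open cdom;
  cimg_open : open (cfun @` cdom);
  cfunK : forall p, cdom p -> cinv (cfun p) = p;
  cfun_continuous : forall p, cdom p -> {for p, continuous cfun};
  cinv_continuous : forall x, (cfun @` cdom) x -> {for x, continuous cinv}
}.

Lemma chart_imgI_open n (T : topologicalType) (a b : chart n T) :
  open (cfun a @` (cdom a `&` cdom b)).
Proof.
have -> : cfun a @` (cdom a `&` cdom b) =
    (cfun a @` cdom a) `&` (cinv a @^-1` cdom b).
  apply/seteqP; split=> [_ [p [ap bp] <-]|_ [[p ap <-]]] /=.
    by split; [exists p|rewrite cfunK].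
  by rewrite cfunK // => bp; exists p.
rewrite openE => _ [[p ap <-] bp].
apply: filterI.
  by apply: open_nbhs_nbhs; split; [exact: cimg_open|exists p].
apply: (cinv_continuous (c := a)); first by exists p.
by apply: open_nbhs_nbhs; split=> //; exact: cdom_open.
Qed.

(* [chart_at p] is a preferred chart of the atlas around [p]; it serves to
   represent tangent vectors at [p] by elements of R^n. *)
Record manifold (n : nat) := Manifold {
  carrier :> topologicalType;
  manifold_hausdorff : hausdorff_space carrier;
  manifold_second_countable : @second_countable carrier;
  atlas : set (chart n carrier);
  chart_at : carrier -> chart n carrier;
  chart_at_atlas : forall p, atlas (chart_at p);
  chart_at_dom : forall p, cdom (chart_at p) p;
  transition_smooth : forall a b, atlas a -> atlas b ->
    smooth_on (cfun a @` (cdom a `&` cdom b)) (cfun b \o cinv a)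
}.

Arguments atlas {n} _.

Definition row_mxl m n (u : 'rV[R]_m) : 'rV[R]_(m + n) := row_mx u 0.
Definition row_mxr m n (u : 'rV[R]_n) : 'rV[R]_(m + n) := row_mx 0 u.

Fact row_mxl_linear m n : linear (@row_mxl m n).
Proof.
by move=> a u v; rewrite /row_mxl scale_row_mx add_row_mx scaler0 addr0.
Qed.
Fact row_mxr_linear m n : linear (@row_mxr m n).
Proof.
by move=> a u v; rewrite /row_mxr scale_row_mx add_row_mx scaler0 addr0.
Qed.
HB.instance Definition _ m n :=
  GRing.isLinear.Build R _ _ _ (@row_mxl m n) (@row_mxl_linear m n).
HB.instance Definition _ m n :=
  GRing.isLinear.Build R _ _ _ (@row_mxr m n) (@row_mxr_linear m n).

Lemma row_mxl_continuous m n : continuous (@row_mxl m n).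
Proof.
move=> u A /nbhs_ballP[e /= e0 eA].
apply/nbhs_ballP; exists e => //= v [_ uv]; apply: eA; split => // i j.
rewrite !mxE; case: splitP => k _; first exact: uv.
by rewrite !mxE; exact: ballxx.
Qed.

Lemma row_mxr_continuous m n : continuous (@row_mxr m n).
Proof.
move=> u A /nbhs_ballP[e /= e0 eA].
apply/nbhs_ballP; exists e => //= v [_ uv]; apply: eA; split => // i j.
rewrite !mxE; case: splitP => k _; last exact: uv.
by rewrite !mxE; exact: ballxx.
Qed.

Lemma row_mxE m n (u : 'rV[R]_m) (v : 'rV[R]_n) :
  row_mx u v = row_mxl n u + row_mxr m v.
Proof. by rewrite add_row_mx addr0 add0r. Qed.

Section Product.
Context {m n : nat}.

Section ProductChart.
Context {S T : topologicalType} (a : chart m S) (b : chart n T).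

Let pdom : set (S * T) := cdom a `*` cdom b.
Let pfun (p : S * T) : 'rV[R]_(m + n) := row_mx (cfun a p.1) (cfun b p.2).
Let pinv (x : 'rV[R]_(m + n)) : S * T := (cinv a (lsubmx x), cinv b (rsubmx x)).

Lemma prod_chart_imgE (A : set S) (B : set T) :
  pfun @` (A `*` B) =
  (lsubmx @^-1` (cfun a @` A)) `&` (rsubmx @^-1` (cfun b @` B)).
Proof.
apply/seteqP; split=> [_ [[s t] [/= As Bt] <-]|x [[s As ss] [t Bt tt]]].
  by split=> /=; rewrite ?row_mxKl ?row_mxKr; [exists s|exists t].
by exists (s, t) => //; rewrite /pfun /= ss tt hsubmxK.
Qed.

Fact prod_chart_dom_open : open pdom.
Proof.
by apply: open_setX; exact: cdom_open.
Qed.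

Fact prod_chart_img_open : open (pfun @` pdom).
Proof.
rewrite prod_chart_imgE; apply: openI.
  by apply: open_comp; [move=> x _; exact: continuous_lsubmx|exact: cimg_open].
by apply: open_comp; [move=> x _; exact: continuous_rsubmx|exact: cimg_open].
Qed.

Fact prod_chart_funK p : pdom p -> pinv (pfun p) = p.
Proof.
case: p => s t [/= As Bt].
by rewrite /pinv /pfun row_mxKl row_mxKr !cfunK.
Qed.

Fact prod_chart_fun_continuous p : pdom p -> {for p, continuous pfun}.
Proof.
case: p => s t [/= As Bt].
rewrite /prop_for /continuous_at.
have -> : pfun = (fun p => row_mxl n (cfun a p.1) + row_mxr m (cfun b p.2)).
  by apply/funext => p; exact: row_mxE.
apply: (@cvgD _ _ _ _ _ (fun p => row_mxl n (cfun a p.1))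
   (fun p => row_mxr m (cfun b p.2))).
  apply: (@continuous_comp _ _ _ (fun p => cfun a p.1) (@row_mxl m n)).
    by apply: continuous_comp; [exact: cvg_fst|exact: cfun_continuous].
  exact: row_mxl_continuous.
apply: (@continuous_comp _ _ _ (fun p => cfun b p.2) (@row_mxr m n)).
  by apply: continuous_comp; [exact: cvg_snd|exact: cfun_continuous].
exact: row_mxr_continuous.
Qed.

Fact prod_chart_inv_continuous x :
  (pfun @` pdom) x -> {for x, continuous pinv}.
Proof.
rewrite prod_chart_imgE => -[/= xa xb].
have ca : {for x, continuous (cinv a \o lsubmx)}.
  by apply: continuous_comp; [exact: continuous_lsubmx|exact: cinv_continuous].
have cb : {for x, continuous (cinv b \o rsubmx)}.
  by apply: continuous_comp; [exact: continuous_rsubmx|exact: cinv_continuous].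
exact: (cvg_pair ca cb).
Qed.

Definition prod_chart : chart (m + n) (S * T)%type :=
  Chart prod_chart_dom_open prod_chart_img_open prod_chart_funK
    prod_chart_fun_continuous prod_chart_inv_continuous.

End ProductChart.

Section ProductManifold.
Context (M : manifold m) (N : manifold n).

Let patlas : set (chart (m + n) (M * N)%type) :=
  [set prod_chart a b | a in atlas M & b in atlas N].
Let pchart_at (p : M * N) := prod_chart (chart_at p.1) (chart_at p.2).

Fact prod_hausdorff : hausdorff_space (M * N)%type.
Proof.
move=> [s t] [s' t'] st; congr pair.
  apply: manifold_hausdorff => A B sA s'B.
  have nA : nbhs (s, t) (A `*` setT)
    by exists (A, setT); first by split=> //; exact: filterT.
  have nB : nbhs (s', t') (B `*` setT)
    by exists (B, setT); first by split=> //; exact: filterT.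
  by have [[u v] [/= [Au _] [Bu _]]] := st _ _ nA nB; exists u.
apply: manifold_hausdorff => A B tA t'B.
have nA : nbhs (s, t) (setT `*` A)
  by exists (setT, A); first by split=> //; exact: filterT.
have nB : nbhs (s', t') (setT `*` B)
  by exists (setT, B); first by split=> //; exact: filterT.
by have [[u v] [/= [_ Av] [_ Bv]]] := st _ _ nA nB; exists v.
Qed.

Fact prod_second_countable : @second_countable (M * N)%type.
Proof.
have [A cA [oA bA]] := manifold_second_countable M.
have [B cB [oB bB]] := manifold_second_countable N.
exists [set a `*` b | a in A & b in B].
  have -> : [set a `*` b | a in A & b in B] =
      (fun ab => ab.1 `*` ab.2) @` (A `*` B).
    apply/seteqP; split=> [_ [a Aa [b Bb <-]]|_ [[a b] [/= Aa Bb] <-]].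
      by exists (a, b).
    by exists a => //; exists b.
  by apply: card_le_trans (card_image_le _ _) _; exact: countableX.
split=> [_ [a Aa [b Bb <-]]|[s t] C [[U V] [/= sU tV] UVC]].
  by apply: open_setX; [exact: oA|exact: oB].
have [a [Aa as_] aU] := bA s U sU.
have [b [Bb bt] bV] := bB t V tV.
exists (a `*` b); last first.
  by move=> [u v] [/= ? ?]; apply: UVC; split; [exact: aU|exact: bV].
by split; [exists a => //; exists b|split].
Qed.

Fact prod_chart_at_atlas p : patlas (pchart_at p).
Proof.
by exists (chart_at p.1); [exact: chart_at_atlas|
  exists (chart_at p.2) => //; exact: chart_at_atlas].
Qed.

Fact prod_chart_at_dom p : cdom (pchart_at p) p.
Proof. by split; exact: chart_at_dom. Qed.

Fact prod_transition_smooth a b : patlas a -> patlas b ->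
  smooth_on (cfun a @` (cdom a `&` cdom b)) (cfun b \o cinv a).
Proof.
move=> [a1 Aa1 [a2 Aa2 <-]] [b1 Ab1 [b2 Ab2 <-]] k.
have -> : cfun (prod_chart a1 a2) @`
    (cdom (prod_chart a1 a2) `&` cdom (prod_chart b1 b2)) =
  (lsubmx @^-1` (cfun a1 @` (cdom a1 `&` cdom b1))) `&`
  (rsubmx @^-1` (cfun a2 @` (cdom a2 `&` cdom b2))).
  by rewrite -setXI prod_chart_imgE.
have -> : cfun (prod_chart b1 b2) \o cinv (prod_chart a1 a2) =
  (fun x => row_mxl n ((cfun b1 \o cinv a1) (lsubmx x))) \+
  (fun x => row_mxr m ((cfun b2 \o cinv a2) (rsubmx x))).
  by apply/funext => x /=; rewrite -row_mxE.
have o1 := @chart_imgI_open _ _ a1 b1.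
have o2 := @chart_imgI_open _ _ a2 b2.
have cl : continuous (lsubmx : 'rV[R]_(m + n) -> 'rV[R]_m).
  exact: continuous_lsubmx.
have cr : continuous (rsubmx : 'rV[R]_(m + n) -> 'rV[R]_n).
  exact: continuous_rsubmx.
have op1 : open ((lsubmx : 'rV[R]_(m + n) -> 'rV[R]_m) @^-1`
    (cfun a1 @` (cdom a1 `&` cdom b1)))
  by apply: open_comp => // x _; exact: cl.
have op2 : open ((rsubmx : 'rV[R]_(m + n) -> 'rV[R]_n) @^-1`
    (cfun a2 @` (cdom a2 `&` cdom b2)))
  by apply: open_comp => // x _; exact: cr.
apply: CkD; first exact: openI.
  apply: Ck_sub (Ck_lin cl (@row_mxl_continuous m n) o1
    (transition_smooth Aa1 Ab1 k)).
  by move=> x [].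
apply: Ck_sub (Ck_lin cr (@row_mxr_continuous m n) o2
  (transition_smooth Aa2 Ab2 k)).
by move=> x [].
Qed.

Definition prod_manifold : manifold (m + n) :=
  Manifold prod_hausdorff prod_second_countable prod_chart_at_atlas
    prod_chart_at_dom prod_transition_smooth.

End ProductManifold.
End Product.

(* A tangent vector at [p] is represented by its coordinates in the preferred
   chart at [p]; differentials below are accordingly read in preferred charts,
   and [of_chart] changes coordinates from another chart. *)
Definition tangent n (M : manifold n) (p : M) : Type := 'rV[R]_n.
HB.instance Definition _ n (M : manifold n) (p : M) :=
  NormedModule.copy (tangent p) 'rV[R]_n.

Definition vector_field n (M : manifold n) := forall p : M, tangent p.

Definition smooth n (M : manifold n) (f : M -> R) :=
  forall a, atlas M a -> smooth_on (cfun a @` cdom a) (f \o cinv a).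

Definition tdiff m n (M : manifold m) (N : manifold n) (F : M -> N)
    (p : M) : tangent p -> tangent (F p) :=
  'd (cfun (chart_at (F p)) \o F \o cinv (chart_at p)) (cfun (chart_at p) p).

Definition fdiff n (M : manifold n) (f : M -> R) (p : M) : tangent p -> R :=
  'd (f \o cinv (chart_at p)) (cfun (chart_at p) p).

(* The tangent vector at [cinv a x] whose coordinates in the chart [a] are
   [v]. *)
Definition of_chart n (M : manifold n) (a : chart n M) (x v : 'rV[R]_n) :
    tangent (cinv a x) :=
  'd (cfun (chart_at (cinv a x)) \o cinv a) x v.

Definition tensor02 n (M : manifold n) :=
  forall p : M, tangent p -> tangent p -> R.

Definition pullback m n (M : manifold m) (N : manifold n) (F : M -> N)
    (g : tensor02 N) : tensor02 M :=
  fun p u v => g (F p) (tdiff F u) (tdiff F v).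

Definition odot (V : Type) (alpha beta : V -> R) (u v : V) : R :=
  alpha u * beta v + beta u * alpha v.

Record riemannian_metric n (M : manifold n) := RiemannianMetric {
  riem_tensor :> tensor02 M;
  riem_linear : forall p u, scalar (riem_tensor (p := p) u);
  riem_sym : forall p (u v : tangent p), riem_tensor u v = riem_tensor v u;
  riem_gt0 : forall p (u : tangent p), u != 0 -> 0 < riem_tensor u u;
  riem_smooth : forall a, atlas M a -> forall u v : 'rV[R]_n,
    smooth_on (cfun a @` cdom a)
      (fun x => riem_tensor (of_chart a x u) (of_chart a x v))
}.

Arguments riem_tensor {n M} _ p u v.

Definition tnorm n (M : manifold n) (g : tensor02 M) p (u : tangent p) : R :=
  Num.sqrt (g p u u).

(* [xget 0 P] is an element satisfying [P] if there is one, and 0 otherwise; for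
   nondegenerate [g] there is exactly one here. *)
Definition grad n (M : manifold n) (g : tensor02 M) (f : M -> R) :
    vector_field M :=
  fun p => xget 0 [set u | forall v, g p u v = fdiff f v].

Section WarpedProduct.
Context {n1 n2 : nat} (M1 : manifold n1) (M2 : manifold n2).
Local Notation M := (prod_manifold M1 M2).

Definition pi1 : M -> M1 := fst.
Definition pi2 : M -> M2 := snd.

Definition hfun (f : M1 -> R) : M -> R := f \o pi1.
Definition vfun (f : M2 -> R) : M -> R := f \o pi2.

(* [(tdiff pi1, tdiff pi2)] is an isomorphism onto the product of the tangent
   spaces, so here too [xget] selects from a singleton. *)
Definition hlift (X : vector_field M1) : vector_field M :=
  fun p => xget 0 [set w | tdiff pi1 w = X (pi1 p) /\ tdiff pi2 w = 0].
Definition vlift (X : vector_field M2) : vector_field M :=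
  fun p => xget 0 [set w | tdiff pi1 w = 0 /\ tdiff pi2 w = X (pi2 p)].

Definition warped_metric (g1 : tensor02 M1) (g2 : tensor02 M2) (f1 : M1 -> R)
    (f2 : M2 -> R) (c : R) : tensor02 M := fun p u v =>
  vfun f2 p ^+ 2 * pullback pi1 g1 u v + hfun f1 p ^+ 2 * pullback pi2 g2 u v +
  c * hfun f1 p * vfun f2 p *
    odot (fdiff (hfun f1) (p := p)) (fdiff (vfun f2) (p := p)) u v.

End WarpedProduct.
End Manifold.

Arguments manifold R n : clear implicits.
Arguments atlas {R n} _.
Arguments riem_tensor {R n M} _ p u v.

(* Main.v *)
From HB Require Import structures.
Require Import Defs.
From mathcomp Require Import all_boot all_order all_algebra.
From mathcomp Require Import all_classical all_reals.
From mathcomp Require Import topology normedtype landau derive.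
From mathcomp Require Import ring lra.
Import Order.TTheory GRing.Theory Num.Theory.
Import numFieldNormedType.Exports.
Local Open Scope ring_scope.

(* In the product charts the metric G reads
     G(u, v) = f2^2 g1(u1, v1) + f1^2 g2(u2, v2)
       + c f1 f2 (df1(u1) df2(v2) + df2(u2) df1(v1)),
   and df1, df2 are dual to grad f1, grad f2. Testing G(w, .) = al df1 + be df2
   on vectors (v1, 0) and (0, v2) forces w1 and w2 to be multiples of grad f1
   and grad f2, with coefficients involving df2(w2) and df1(w1). Applying df1
   and df2 gives a 2x2 linear system for these two numbers, of determinant
   1 - c^2 b1 b2, which makes w explicit and unique. *)

(** * Linear algebra of a metric on one tangent space *)

Lemma scalar_row_sum {R : realType} {n : nat} {l : 'rV[R]_n -> R} :
  scalar l -> forall v, l v = \sum_j v 0 j * l 'e_j.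
Proof.
move=> ll v.
pose L := GRing.isLinear.Build R 'rV[R]_n R _ l ll.
pose l' : {linear 'rV[R]_n -> R | *%R} := HB.pack l L.
rewrite [v in LHS]row_sum_delta -[l _]/(l' _) linear_sum.
by apply: eq_bigr => j _; rewrite linearZ.
Qed.

Section Metric.
Context {R : realType} {n : nat} {M : manifold R n} (g : riemannian_metric M).
Implicit Types p : M.
Local Notation gT := (riem_tensor g).

Lemma riem_linearl p (v : tangent p) : scalar (fun u => gT p u v).
Proof. by move=> a u w; rewrite !(riem_sym _ _ v) riem_linear. Qed.

Lemma riem0r p (u : tangent p) : gT p u 0 = 0.
Proof.
have := riem_linear g u 1 0 0; rewrite scaler0 addr0 mul1r => /eqP.
by rewrite eq_sym -subr_eq0 addrK => /eqP.
Qed.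

Lemma riemZl p a (u v : tangent p) : gT p (a *: u) v = a * gT p u v.
Proof.
by rewrite -[a *: u]addr0 riem_linearl [X in _ + X]riem_sym riem0r addr0.
Qed.

(** Positive definiteness at u - w: by linearity g(u - w, u - w) = g(u, u - w) - g(w, u - w), which
    vanishes by hypothesis. *)
Lemma riem_inj p (u w : tangent p) :
  (forall v, gT p u v = gT p w v) -> u = w.
Proof.
move=> uw; apply/eqP; rewrite -subr_eq0; apply: contraT => /(riem_gt0 g).
have -> : u - w = (-1) *: w + u by rewrite scaleN1r addrC.
by rewrite riem_linearl uw; move: (gT p w _) => x; rewrite mulN1r addNr ltxx.
Qed.

(** The Gram matrix [A] of the standard basis is invertible, so u is found by solving u A =
    (l(e_j))_j. *)
Lemma riem_riesz p (l : tangent p -> R) : scalar l ->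
  exists u, forall v, gT p u v = l v.
Proof.
move=> ll; pose A : 'M[R]_n := \matrix_(i, j) gT p 'e_i 'e_j.
have AE (u : 'rV[R]_n) j : (u *m A) 0 j = gT p u 'e_j.
  rewrite (scalar_row_sum (riem_linearl p 'e_j)) mxE.
  by apply: eq_bigr => i _; rewrite mxE.
have gE (u v : tangent p) : gT p u v = \sum_j v 0 j * gT p u 'e_j.
  exact: scalar_row_sum (riem_linear g u) v.
have Au : A \in unitmx.
  rewrite -row_free_unit -kermx_eq0; apply/eqP/row_matrixP => i.
  (* A row of the kernel of [A] is orthogonal to every e_j, hence zero by [riem_inj]. *)
  have k0 : row i (kermx A) *m A = 0 by rewrite -row_mul mulmx_ker row0.
  rewrite row0; apply: (@riem_inj p) => v.
  rewrite gE [RHS]gE; apply: eq_bigr => j _; congr (_ * _).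
  by rewrite -!AE k0 mul0mx.
exists ((\row_j l 'e_j) *m invmx A) => v.
rewrite gE (scalar_row_sum ll); apply: eq_bigr => j _; congr (_ * _).
by rewrite -AE mulmxKV // mxE.
Qed.

(** Riesz representation makes the set in [grad] inhabited, so [xget] does not fall back on its
    default 0. *)
Lemma gradE (f : M -> R) p v : gT p (grad g f p) v = fdiff f v.
Proof.
have ex : exists u : tangent p, forall v, gT p u v = fdiff f v.
  by apply: riem_riesz => a u w; rewrite /fdiff linearP.
exact: (xgetPex 0 ex).
Qed.

Lemma tnorm_sqr p (u : tangent p) : tnorm g u ^+ 2 = gT p u u.
Proof.
rewrite sqr_sqrtr //; have [->|/(riem_gt0 g)/ltW//] := eqVneq u 0.
by rewrite riem0r.
Qed.

End Metric.

(** * Projections, lifts and differentials in product charts *)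

Section ProductDifferentials.
Context {R : realType} {n1 n2 : nat} {M1 : manifold R n1} {M2 : manifold R n2}.
Local Notation M := (prod_manifold M1 M2).

(** This composite is the identity only on the image of the chart; that image is open, so the
    identity holds near the point, which suffices for differentials. *)
Let near_chart n (T : topologicalType) (a : @chart R n T) (t : T) : cdom a t ->
  \forall x \near cfun a t, cfun a (cinv a x) = x.
Proof.
move=> at_; have : nbhs (cfun a t) (cfun a @` cdom a)%classic.
  by apply: open_nbhs_nbhs; split; [exact: cimg_open|exists t].
by apply: filterS => _ [s as_ <-]; rewrite cfunK.
Qed.


(** Read in charts, a projection agrees near x with the linear map [L] extracting a block of
    coordinates, so its differential is [L]. *)
Let proj_chart m n (T : topologicalType) (a : @chart R n T) (t : T)
    (L : {linear 'rV[R]_m -> 'rV[R]_n}) (x : 'rV[R]_m) :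
  continuous L -> L x = cfun a t -> cdom a t ->
  'd (cfun a \o (cinv a \o L)) x = L :> ('rV[R]_m -> 'rV[R]_n).
Proof.
move=> cL Lx at_; have dL : differentiable L x.
  exact: linear_differentiable.
have Ln : \forall y \near x, L y = (cfun a \o (cinv a \o L)) y.
  have H : \forall y \near x, cfun a (cinv a (L y)) = L y.
    have nLx : nbhs (L x) [set z | cfun a (cinv a z) = z]%classic.
      by rewrite Lx; exact: near_chart.
    exact: cL x _ nLx.
  by near=> y; rewrite /= (near H y).
by have [_ ->] := diff_near_eq Ln dL; rewrite diff_lin.
Unshelve. all: by end_near. Qed.

Lemma tdiff_pi1 (p : M) (u : tangent p) :
  tdiff (@pi1 _ _ _ M1 M2) u = lsubmx (u : 'rV_(n1 + n2)).
Proof.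
rewrite /tdiff (@proj_chart _ _ _ _ p.1 lsubmx) //=.
- exact: continuous_lsubmx.
- by rewrite row_mxKl.
- exact: chart_at_dom.
Qed.

Lemma tdiff_pi2 (p : M) (u : tangent p) :
  tdiff (@pi2 _ _ _ M1 M2) u = rsubmx (u : 'rV_(n1 + n2)).
Proof.
rewrite /tdiff (@proj_chart _ _ _ _ p.2 rsubmx) //=.
- exact: continuous_rsubmx.
- by rewrite row_mxKr.
- exact: chart_at_dom.
Qed.

(** The two projections determine both blocks of w, so the set in [hlift] is a singleton. *)
Lemma hliftE (X : vector_field M1) (p : M) :
  hlift X p = row_mx (X p.1) 0 :> 'rV_(n1 + n2).
Proof.
apply: xget_unique => /=.
  by rewrite tdiff_pi1 tdiff_pi2 row_mxKl row_mxKr.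
move=> w []; rewrite tdiff_pi1 tdiff_pi2 => <- <-.
by rewrite hsubmxK.
Qed.

Lemma vliftE (X : vector_field M2) (p : M) :
  vlift X p = row_mx 0 (X p.2) :> 'rV_(n1 + n2).
Proof.
apply: xget_unique => /=.
  by rewrite tdiff_pi1 tdiff_pi2 row_mxKl row_mxKr.
move=> w []; rewrite tdiff_pi1 tdiff_pi2 => <- <-.
by rewrite hsubmxK.
Qed.

Let fdiff_lin m n (N : manifold R n) (f : N -> R) (q : N)
    (L : {linear 'rV[R]_m -> 'rV[R]_n}) (x u : 'rV[R]_m) :
  smooth f -> continuous L -> L x = cfun (chart_at q) q ->
  'd ((f \o cinv (chart_at q)) \o L) x u = fdiff f (L u : tangent q).
Proof.
move=> sf cL Lx; have dL : differentiable L x.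
  exact: linear_differentiable.
have df : differentiable (f \o cinv (chart_at q)) (L x).
  (* Order 1 of smoothness supplies the differentiability that the chain rule asks for. *)
  have [+ _] := sf _ (chart_at_atlas q) 1%N; apply.
  by exists q => //; exact: chart_at_dom.
by rewrite diff_comp // /fdiff -Lx /= diff_lin.
Qed.

Lemma fdiff_hfun (f : M1 -> R) (p : M) (u : tangent p) : smooth f ->
  fdiff (hfun f : M -> R) u =
  fdiff f (lsubmx (u : 'rV_(n1 + n2)) : tangent p.1).
Proof.
move=> sf; apply: (@fdiff_lin _ _ _ _ p.1 lsubmx) => //.
  exact: continuous_lsubmx.
by rewrite /= row_mxKl.
Qed.

Lemma fdiff_vfun (f : M2 -> R) (p : M) (u : tangent p) : smooth f ->
  fdiff (vfun f : M -> R) u =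
  fdiff f (rsubmx (u : 'rV_(n1 + n2)) : tangent p.2).
Proof.
move=> sf; apply: (@fdiff_lin _ _ _ _ p.2 rsubmx) => //.
  exact: continuous_rsubmx.
by rewrite /= row_mxKr.
Qed.

End ProductDifferentials.

(** * Duality for the warped metric *)

Section WarpedGradient.
Context {R : realType} {n1 n2 : nat} {M1 : manifold R n1} {M2 : manifold R n2}.
Context (g1 : riemannian_metric M1) (g2 : riemannian_metric M2).
Context (f1 : M1 -> R) (f2 : M2 -> R) (c : R).
Hypotheses (sf1 : smooth f1) (sf2 : smooth f2).
Local Notation M := (prod_manifold M1 M2).
Local Notation G := (warped_metric g1 g2 f1 f2 c : tensor02 M).
Local Notation k1 := (grad g1 f1).
Local Notation k2 := (grad g2 f2).

(** Writing df1 and df2 as pairings with the gradients leaves only [g1] and [g2], so the rest is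
    algebra. *)
Lemma warped_metricE (p : M) (u v : 'rV[R]_(n1 + n2)) :
  G p u v = f2 p.2 ^+ 2 * riem_tensor g1 p.1 (lsubmx u) (lsubmx v)
    + f1 p.1 ^+ 2 * riem_tensor g2 p.2 (rsubmx u) (rsubmx v)
    + c * f1 p.1 * f2 p.2 *
      (riem_tensor g1 p.1 (k1 p.1) (lsubmx u)
         * riem_tensor g2 p.2 (k2 p.2) (rsubmx v)
       + riem_tensor g2 p.2 (k2 p.2) (rsubmx u)
         * riem_tensor g1 p.1 (k1 p.1) (lsubmx v)).
Proof.
rewrite /warped_metric /pullback /odot !tdiff_pi1 !tdiff_pi2.
by rewrite !fdiff_hfun // !fdiff_vfun // !gradE.
Qed.

(* The form al df1 + be df2 is arbitrary so that both gradients are instances: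
   (al, be) = (1, 0) for f1 and (0, 1) for f2. *)
Lemma warped_dualP (p : M) (al be : R) (w : 'rV[R]_(n1 + n2)) :
  let b1 := riem_tensor g1 p.1 (k1 p.1) (k1 p.1) in
  let b2 := riem_tensor g2 p.2 (k2 p.2) (k2 p.2) in
  let D := 1 - c ^+ 2 * b1 * b2 in
  f1 p.1 != 0 -> f2 p.2 != 0 -> D != 0 ->
  (forall v : 'rV[R]_(n1 + n2), G p w v =
     al * riem_tensor g1 p.1 (k1 p.1) (lsubmx v)
     + be * riem_tensor g2 p.2 (k2 p.2) (rsubmx v)) <->
  w = row_mx
    (D^-1 * (al / f2 p.2 ^+ 2 - c * b2 * be / (f1 p.1 * f2 p.2)) *: k1 p.1)
    (D^-1 * (be / f1 p.1 ^+ 2 - c * b1 * al / (f1 p.1 * f2 p.2)) *: k2 p.2).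
Proof.
move=> b1 b2 D F1 F2 D0; split=> [Gw|-> v]; last first.
  (* Converse: after substitution, the pairings of the gradients with v are free variables of a
     rational identity. *)
  rewrite warped_metricE row_mxKl row_mxKr !riemZl.
  rewrite !(riem_sym _ (k1 p.1) (_ *: _)) !(riem_sym _ (k2 p.2) (_ *: _)).
  rewrite !riemZl -/b1 -/b2; clearbody b1 b2; move: D0; rewrite /D.
  move: (riem_tensor _ _ _ _) (riem_tensor _ _ _ _) => A B D0.
  by field; rewrite F1 F2 D0.
rewrite -[w]hsubmxK; move: Gw; set a := lsubmx w; set b := rsubmx w => Gw.
(* The unknowns of the 2x2 system: x = df1(w1) and y = df2(w2). *)
set x := riem_tensor g1 p.1 (k1 p.1) a.
set y := riem_tensor g2 p.2 (k2 p.2) b.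
have Ea : a = ((al - c * f1 p.1 * f2 p.2 * y) / f2 p.2 ^+ 2) *: k1 p.1.
  apply: (riem_inj g1 p.1) => v1; have := Gw (row_mx v1 0).
  rewrite warped_metricE row_mxKl row_mxKr !riem0r riemZl -/a -/b -/y.
  move: (riem_tensor g1 p.1 a v1) (riem_tensor g1 p.1 (k1 p.1) v1) => A B E.
  apply: (mulfI (expf_neq0 2 F2)).
  (* The middle term separates the linear consequence of [E] from the cancellation of f2^2. *)
  apply: (etrans (y := al * B - c * f1 p.1 * f2 p.2 * y * B)).
    by move: E; clearbody y; lra.
  by field.
have Eb : b = ((be - c * f1 p.1 * f2 p.2 * x) / f1 p.1 ^+ 2) *: k2 p.2.
  apply: (riem_inj g2 p.2) => v2; have := Gw (row_mx 0 v2).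
  rewrite warped_metricE row_mxKl row_mxKr !riem0r riemZl -/a -/b -/x.
  move: (riem_tensor g2 p.2 b v2) (riem_tensor g2 p.2 (k2 p.2) v2) => A B E.
  apply: (mulfI (expf_neq0 2 F1)).
  apply: (etrans (y := be * B - c * f1 p.1 * f2 p.2 * x * B)).
    by move: E; clearbody x; lra.
  by field.
(* Pairing [Ea] with grad f1, and [Eb] with grad f2, closes the system in x and y. *)
have Ex : x = (al - c * f1 p.1 * f2 p.2 * y) / f2 p.2 ^+ 2 * b1.
  by rewrite /x {1}Ea riem_sym riemZl.
have Ey : y = (be - c * f1 p.1 * f2 p.2 * x) / f1 p.1 ^+ 2 * b2.
  by rewrite /y {1}Eb riem_sym riemZl.
(* Eliminating y produces c^2 b1 b2 x, which cancels against the same term of D x. *)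
have Dx : D * x = (al / f2 p.2 ^+ 2 - c * b2 * be / (f1 p.1 * f2 p.2)) * b1.
  by rewrite /D mulrBl mul1r {1}Ex Ey; field; rewrite F1 F2.
have Dy : D * y = (be / f1 p.1 ^+ 2 - c * b1 * al / (f1 p.1 * f2 p.2)) * b2.
  by rewrite /D mulrBl mul1r {1}Ey Ex; field; rewrite F1 F2.
congr row_mx.
  rewrite {1}Ea; congr (_ *: _); apply: (mulfI D0); rewrite mulVKf //.
  by rewrite mulrA mulrBr mulrCA Dy /D; field; rewrite F1 F2.
rewrite {1}Eb; congr (_ *: _); apply: (mulfI D0); rewrite mulVKf //.
by rewrite mulrA mulrBr mulrCA Dx /D; field; rewrite F1 F2.
Qed.

(** The two directions of [warped_dualP] give existence and uniqueness of the vector that [xget]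
    selects. *)
Lemma grad_warped (h : M -> R) (p : M) (al be : R) :
  let b1 := riem_tensor g1 p.1 (k1 p.1) (k1 p.1) in
  let b2 := riem_tensor g2 p.2 (k2 p.2) (k2 p.2) in
  let D := 1 - c ^+ 2 * b1 * b2 in
  f1 p.1 != 0 -> f2 p.2 != 0 -> D != 0 ->
  (forall v : 'rV[R]_(n1 + n2), fdiff h (v : tangent p) =
     al * riem_tensor g1 p.1 (k1 p.1) (lsubmx v)
     + be * riem_tensor g2 p.2 (k2 p.2) (rsubmx v)) ->
  grad G h p =
    (D^-1 * (al / f2 p.2 ^+ 2 - c * b2 * be / (f1 p.1 * f2 p.2)))
      *: hlift k1 p +
    (D^-1 * (be / f1 p.1 ^+ 2 - c * b1 * al / (f1 p.1 * f2 p.2)))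
      *: vlift k2 p.
Proof.
move=> b1 b2 D F1 F2 D0 dh.
have dualP w := @warped_dualP p al be w F1 F2 D0.
rewrite hliftE vliftE !scale_row_mx !scaler0 add_row_mx addr0 add0r.
apply: xget_unique => [v|w Gw] /=.
  by rewrite dh; apply: (iffRL (dualP _)).
by apply/dualP => v; rewrite Gw dh.
Qed.

End WarpedGradient.

Theorem lemma3p2 (R : realType) (n1 n2 : nat)
    (M1 : manifold R n1) (M2 : manifold R n2)
    (g1 : riemannian_metric M1) (g2 : riemannian_metric M2)
    (f1 : M1 -> R) (f2 : M2 -> R) (c : R)
    (f1_smooth : smooth f1) (f2_smooth : smooth f2)
    (f1_gt0 : forall x, 0 < f1 x) (f2_gt0 : forall y, 0 < f2 y) :
  let M := prod_manifold M1 M2 in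
  let G : tensor02 M := warped_metric g1 g2 f1 f2 c in
  let f1h : M -> R := hfun f1 in
  let f2v : M -> R := vfun f2 in
  let b1h : M -> R := hfun (fun x => tnorm g1 (grad g1 f1 x) ^+ 2) in
  let b2v : M -> R := vfun (fun y => tnorm g2 (grad g2 f2 y) ^+ 2) in
  (forall p : M, 0 <= c ^+ 2 * b1h p * b2v p < 1) ->
  (forall p : M, grad G f1h p =
     (1 / (1 - c ^+ 2 * b1h p * b2v p)) *:
       ((1 / f2v p ^+ 2) *: hlift (grad g1 f1) p
        - (c * b1h p / (f1h p * f2v p)) *: vlift (grad g2 f2) p)) /\
  (forall p : M, grad G f2v p =
     (1 / (1 - c ^+ 2 * b1h p * b2v p)) *:
       ((1 / f1h p ^+ 2) *: vlift (grad g2 f2) p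
        - (c * b2v p / (f1h p * f2v p)) *: hlift (grad g1 f1) p)).

Proof.
move=> M G f1h f2v b1h b2v D1.
have D0 p : 1 - c ^+ 2 * b1h p * b2v p != 0.
  by have /andP[_ D1p] := D1 p; rewrite gt_eqF // subr_gt0.
have b1E p : riem_tensor g1 p.1 (grad g1 f1 p.1) (grad g1 f1 p.1) = b1h p.
  by rewrite -tnorm_sqr.
have b2E p : riem_tensor g2 p.2 (grad g2 f2 p.2) (grad g2 f2 p.2) = b2v p.
  by rewrite -tnorm_sqr.
split=> p.
  rewrite (grad_warped g1 g2 f1 f2 c f1_smooth f2_smooth f1h p 1 0).
  - rewrite b1E b2E scalerBr !scalerA -scaleNr; congr (_ *: _ + _ *: _).
      by rewrite mulr0 mul0r subr0 !mul1r.
    by rewrite mulr1 mul0r sub0r mulrN mul1r.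
  - exact: lt0r_neq0.
  - exact: lt0r_neq0.
  - by rewrite b1E b2E.
  - by move=> v; rewrite fdiff_hfun // -(gradE g1) mul1r mul0r addr0.
rewrite (grad_warped g1 g2 f1 f2 c f1_smooth f2_smooth f2v p 0 1).
(* The formula for f2 lists the vertical term first, hence [addrC]. *)
- rewrite b1E b2E scalerBr !scalerA -scaleNr addrC; congr (_ *: _ + _ *: _).
    by rewrite mulr0 mul0r subr0 !mul1r.
  by rewrite mulr1 mul0r sub0r mulrN mul1r.
- exact: lt0r_neq0.
- exact: lt0r_neq0.
- by rewrite b1E b2E.
- by move=> v; rewrite fdiff_vfun // -(gradE g2) mul1r mul0r add0r.
Qed.
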